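(* For any real $\zeta>1$ and any real $b>a$, the set $\Delta_{\infty}(\zeta)\cap(a,b)$ has the same cardinality as $\mathbb{R}$. In particular $\Delta_{\infty}(\zeta)$ is dense in $\mathbb{R}$.
   Context: For real $x$, $\Vert x\Vert$ denotes the distance from $x$ to the nearest integer. For real $\alpha\neq 0$ and $\zeta>1$, $$\overline{\sigma}(\alpha,\zeta):=\limsup_{n\to\infty}-\frac{\log\Vert\alpha\zeta^{n}\Vert}{n\log\zeta},$$ where $n$ runs through the positive integers and the quotient is read as $+\infty$ when $\Vert\alpha\zeta^n\Vert=0$. For real $\zeta>1$, $\Delta_\infty(\zeta)$ denotes the set of real numbers $\alpha$ such that $\overline{\sigma}(\alpha,\zeta)=\infty$. *)

(* Defs.v *)
From mathcomp Require Import all_boot all_order all_algebra.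
From mathcomp Require Import all_classical all_reals all_analysis.
Import Order.TTheory GRing.Theory Num.Theory.
Import numFieldNormedType.Exports.

Set Implicit Arguments.
Unset Strict Implicit.
Unset Printing Implicit Defensive.

Local Open Scope classical_set_scope.
Local Open Scope ring_scope.

Definition dist_int {R : realType} (x : R) : R :=
  inf [set `|x - m%:~R| | m in [set: int]].

(* The library's ln sends 0 to 0, hence the case distinction. *)
Definition sigma_quot {R : realType} (alpha zeta : R) (n : nat) : \bar R :=
  let d := dist_int (alpha * zeta ^+ n) in
  if d == 0 then +oo%E else (- ln d / (n%:R * ln zeta))%:E.

(* The shift makes the exponent run through the positive integers. *)
Definition sigma_bar {R : realType} (alpha zeta : R) : \bar R :=
  limn_esup (fun n => sigma_quot alpha zeta n.+1).

(* sigma_bar alpha zeta is only meaningful for alpha != 0; at alpha = 0 the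
   formula above would give +oo, so 0 has to be excluded here. *)
Definition Delta_infty {R : realType} (zeta : R) : set R :=
  [set alpha | alpha != 0 /\ sigma_bar alpha zeta = +oo%E].

(* Main.v *)
Require Import Defs.
From mathcomp Require Import all_boot all_order all_algebra.
From mathcomp Require Import all_classical all_reals all_analysis.
From mathcomp Require Import ring lra.
Import Order.TTheory GRing.Theory Num.Theory.
Import numFieldNormedType.Exports.

Set Implicit Arguments.
Unset Strict Implicit.
Unset Printing Implicit Defensive.

Local Open Scope classical_set_scope.
Local Open Scope card_scope.
Local Open Scope ring_scope.

(** The set [Delta_infty zeta] contains a Cantor set inside every interval.
    Start from an interval [[l, l + w]].  If [w * zeta ^+ n >= 3], then the
    dilated interval [[l * zeta ^+ n, (l + w) * zeta ^+ n]] contains two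
    consecutive integers [m] and [m + 1], each followed by a margin of length
    [zeta ^- (n ^ 2) <= 1].  Scaling back, the interval has two disjoint
    subintervals, namely those of length [zeta ^- (n + n ^ 2)] starting at
    [m / zeta ^+ n] and at [(m + 1) / zeta ^+ n].  Every [alpha] in one of them
    satisfies [dist_int (alpha * zeta ^+ n) <= zeta ^- (n ^ 2)], which makes
    the quotient defining [sigma_bar] at least [n].  A binary sequence [s] tells
    which half to enter at each step; the exponents used do not depend on [s]
    and grow without bound, so the point [coded] by [s] has
    [sigma_bar = +oo] ([sigma_bar_pinfty]), and distinct sequences code distinct
    points ([coded_inj]).

    Since a real number is determined by the rationals below it ([cut_inj]),
    the reals inject into the binary sequences, and from there into
    [Delta_infty zeta `&` `]a, b[]; the Cantor-Bernstein theorem gives the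
    equality of cardinals.  Density is the nonemptiness of these sets. *)

(** * Powers and nested intervals *)

Lemma expr_unbounded (R : realType) (zeta x : R) :
  1 < zeta -> exists n, x <= zeta ^+ n.
Proof.
move=> z1; have z0 : 0 < zeta by lra.
have [x0|x0] := lerP x 0; first by exists 0; rewrite (le_trans x0).
have lz := ln_gt0 z1; exists (Num.bound `|ln x / ln zeta|).
rewrite -ler_ln ?posrE ?exprn_gt0// lnXn// -[_ *+ _]mulr_natl -ler_pdivrMr//.
exact/ltW/(le_lt_trans (ler_norm _))/archi_boundP.
Qed.

Lemma sup_nested_itv (R : realType) (l w : nat -> R) :
  (forall k, 0 <= w k) -> (forall k, l k <= l k.+1) ->
  (forall k, l k.+1 + w k.+1 <= l k + w k) ->
  forall k, l k <= sup (range l) <= l k + w k.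
Proof.
move=> w0 lS rS k.
have lmon : {homo l : i j / (i <= j)%N >-> i <= j}.
  by apply: homo_leq => // y x z; apply: le_trans.
have rmon : {homo (fun k => l k + w k) : i j / (i <= j)%N >-> i >= j}.
  by apply: homo_leq => // y x z xy yz; apply: le_trans yz xy.
have ub : ubound (range l) (l k + w k).
  move=> _ [j _ <-].
  apply: (le_trans (lmon _ _ (leq_maxl j k))).
  by apply: le_trans (rmon _ _ (leq_maxr j k)); rewrite lerDl.
apply/andP; split; last by apply: ge_sup => //; exists (l 0%N), 0%N.
by apply: ub_le_sup; [exists (l k + w k) | exists k].
Qed.

(** * Points whose dilates are very close to integers *)

Lemma dist_int_le (R : realType) (x : R) (m : int) :
  dist_int x <= `|x - m%:~R|.
Proof.
by apply: ge_inf; [exists 0 => _ [i _ <-] | exists m].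
Qed.

Lemma dist_int_ge0 (R : realType) (x : R) : 0 <= dist_int x.
Proof. by apply: lb_le_inf => [|_ [i _ <-]//]; exists `|x - 0%:~R|, 0. Qed.

Lemma sigma_quot_ge (R : realType) (alpha zeta : R) (n : nat) (m : int) :
  1 < zeta -> (0 < n)%N ->
  `|alpha * zeta ^+ n - m%:~R| <= (zeta ^+ (n ^ 2))^-1 ->
  (n%:R%:E <= sigma_quot alpha zeta n)%E.
Proof.
move=> z1 n0 close; rewrite /sigma_quot.
have z0 : 0 < zeta by lra.
case: eqP => [_|/eqP d0]; first by rewrite leey.
have dgt0 : 0 < dist_int (alpha * zeta ^+ n) by rewrite lt_def d0 dist_int_ge0.
have lz := ln_gt0 z1.
rewrite lee_fin ler_pdivlMr ?mulr_gt0 ?ltr0n// lerNr.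
have -> : - (n%:R * (n%:R * ln zeta)) = ln (zeta ^+ (n ^ 2))^-1.
  rewrite lnV ?posrE ?exprn_gt0// lnXn// -[in RHS]mulr_natl natrX; ring.
rewrite ler_ln ?posrE ?invr_gt0 ?exprn_gt0//.
exact: le_trans (dist_int_le _ m) close.
Qed.

Lemma sigma_bar_pinfty (R : realType) (alpha zeta : R) : 1 < zeta ->
  (forall N, exists n (m : int), (N < n)%N /\
     `|alpha * zeta ^+ n - m%:~R| <= (zeta ^+ (n ^ 2))^-1) ->
  sigma_bar alpha zeta = +oo%E.
Proof.
move=> z1 close; apply/eqP; rewrite -leye_eq; apply: le_ereal_inf_tmp.
move=> _ [V [N _ NV] <-]; rewrite leye_eq; apply/eqP/eqyP => A A0.
have [[|n] [m [Nn hm]]] := close (maxn N (Num.bound A)).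
  by rewrite ltn0 in Nn.
have nV : V n.
  by apply: NV => /=; rewrite -ltnS (leq_ltn_trans (leq_maxl _ _) Nn).
apply: (@le_trans _ _ (sigma_quot alpha zeta n.+1)); last first.
  by apply: ereal_sup_ubound; exists n.
apply: le_trans (sigma_quot_ge z1 (ltn0Sn n) hm); rewrite lee_fin.
apply: ltW; apply: lt_trans (archi_boundP (ltW A0)) _.
by rewrite ltr_nat (leq_ltn_trans (leq_maxr _ _) Nn).
Qed.

(** * The coding of points by binary sequences *)

(** If the current interval has length [zeta ^- (n + n ^ 2)], where
    [n = exps N n0 k], then dilating it by the next power of [zeta] gives it
    length [zeta ^+ N]; a fixed [N] with [3 <= zeta ^+ N] then serves at every
    step. *)
Definition exps (N n0 k : nat) : nat := iter k (fun n => n + n ^ 2 + N)%N n0.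

Definition width {R : realType} (zeta : R) (n : nat -> nat) (k : nat) : R :=
  (zeta ^+ (n k) * zeta ^+ (n k ^ 2))^-1.

Fixpoint left_end {R : realType} (zeta : R) (n : nat -> nat) (c : R)
    (s : nat -> bool) (k : nat) : R :=
  if k is j.+1 then
    (Num.ceil (left_end zeta n c s j * zeta ^+ n k) + (s j : nat)%:Z)%:~R
      / zeta ^+ n k
  else c.

Definition coded {R : realType} (zeta : R) (n : nat -> nat) (c : R)
    (s : nat -> bool) : R :=
  sup (range (left_end zeta n c s)).

Lemma leq_exps (N n0 k : nat) : (0 < N)%N -> (k <= exps N n0 k)%N.
Proof.
move=> N0; elim: k => // k IH; rewrite /exps iterS -/(exps N n0 k).
by rewrite -addn1 leq_add// (leq_trans IH)// leq_addr.
Qed.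

Lemma exps_stretch (R : realType) (zeta : R) (N n0 k : nat) :
  0 < zeta -> 3 <= zeta ^+ N ->
  3 <= width zeta (exps N n0) k * zeta ^+ exps N n0 k.+1.
Proof.
move=> z0; rewrite /width {3}/exps iterS -/(exps N n0 k) !exprD.
have P0 i : zeta ^+ i != 0 by rewrite expf_neq0// gt_eqF.
by rewrite mulKf// mulf_neq0.
Qed.

Lemma width_ge0 (R : realType) (zeta : R) (n : nat -> nat) (k : nat) :
  0 < zeta -> 0 <= width zeta n k.
Proof. by move=> z0; rewrite invr_ge0 mulr_ge0// exprn_ge0// ltW. Qed.

Section Coding.
Context {R : realType} {zeta : R} {n : nat -> nat} {c : R}.
Hypothesis z1 : 1 < zeta.
Hypothesis stretch : forall k, 3 <= width zeta n k * zeta ^+ n k.+1.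

Let P0 i : 0 < zeta ^+ i.
Proof. by rewrite exprn_gt0// (lt_trans ltr01). Qed.

Lemma left_endS s k : left_end zeta n c s k <= left_end zeta n c s k.+1.
Proof.
rewrite /= ler_pdivlMr// intrD.
by rewrite (le_trans (ceil_ge _))// lerDl ler0n.
Qed.

(** In the scale of [zeta ^+ n k.+1], rounding up costs at most [1], the choice
    of the half at most [1], and the new interval has length at most [1]. *)
Lemma right_endS s k :
  left_end zeta n c s k.+1 + width zeta n k.+1 <=
  left_end zeta n c s k + width zeta n k.
Proof.
rewrite /= {1}/width; set l := left_end _ _ _ _ _; set P := zeta ^+ n k.+1.
have P_gt0 : 0 < P := P0 _.
rewrite invfM [P^-1 * _]mulrC -mulrDl ler_pdivrMr// mulrDl.
have := stretch k; have := ceilB1_lt (l * P).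
have : (zeta ^+ (n k.+1 ^ 2))^-1 <= 1 by rewrite invf_le1// exprn_ege1// ltW.
have : (s k : nat)%:R <= 1 :> R by case: (s k).
rewrite -/P intrB intrD -pmulrn; lra.
Qed.

Lemma coded_itv s k :
  left_end zeta n c s k <= coded zeta n c s <=
  left_end zeta n c s k + width zeta n k.
Proof.
apply: sup_nested_itv => [i|i|i]; first exact/width_ge0/(lt_trans ltr01).
- exact: left_endS.
- exact: right_endS.
Qed.

Lemma coded_close s k : exists m : int,
  `|coded zeta n c s * zeta ^+ n k.+1 - m%:~R| <=
  (zeta ^+ (n k.+1 ^ 2))^-1.
Proof.
have := coded_itv s k.+1; rewrite /= /width.
set m : int := (Num.ceil _ + _); exists m; move: H.
have Pn := P0 (n k.+1); rewrite invfM [X in _ + X]mulrC -mulrDl.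
rewrite ler_pdivrMr// ler_pdivlMr// => /andP[lo hi].
by rewrite ger0_norm ?subr_ge0// lerBlDl.
Qed.

Lemma eq_left_end s t k : (forall i, (i < k)%N -> s i = t i) ->
  left_end zeta n c s k = left_end zeta n c t k.
Proof.
elim: k => //= k IH st; rewrite IH ?st// => i ik.
exact/st/(leq_trans ik).
Qed.

Hypothesis n_gt0 : forall k, (0 < n k.+1)%N.

(** At the first place where [s] and [t] differ, the sequence [s] enters the
    interval that starts at an integer [m] (in the scale of the current power of
    [zeta]) and has length less than [1], while [t] enters the one at [m + 1]. *)
Lemma coded_lt s t k : (forall i, (i < k)%N -> s i = t i) ->
  s k = false -> t k = true -> coded zeta n c s < coded zeta n c t.
Proof.
move=> st sk tk; have /andP[_ hs] := coded_itv s k.+1.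
have /andP[ht _] := coded_itv t k.+1.
apply: le_lt_trans hs _; apply: lt_le_trans ht.
rewrite /= (eq_left_end st) sk tk /= /width.
rewrite invfM [X in _ + X]mulrC -mulrDl ltr_pM2r ?invr_gt0//.
rewrite !intrD addr0 ltrD2l invf_lt1//.
by rewrite exprn_egt1// expn_eq0 negb_and -lt0n n_gt0.
Qed.

Lemma coded_inj : injective (coded zeta n c).
Proof.
move=> s t; apply: contraPP => st.
have : exists i, s i != t i.
  apply: contrapT => nst; apply: st; apply/funext => i; apply: contrapT => /eqP.
  by move=> sti; apply: nst; exists i.
move=> ex; have [k kst kmin] := ex_minnP ex.
have agree i : (i < k)%N -> s i = t i.
  by move=> ik; apply/eqP; apply: contraTT ik => /kmin; rewrite -leqNgt.
apply/eqP; move: kst; case Es: (s k); case Et: (t k) => // _.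
  by rewrite gt_eqF// (@coded_lt _ _ k)// => i /agree.
by rewrite lt_eqF// (@coded_lt _ _ k).
Qed.

End Coding.

Lemma sigma_bar_pinfty_cantor (R : realType) (zeta a b : R) :
  1 < zeta -> a < b ->
  exists f : (nat -> bool) -> R, injective f /\
    forall s, a < f s < b /\ sigma_bar (f s) zeta = +oo%E.
Proof.
move=> z1 ab; have z0 : 0 < zeta by lra.
have [N hN] := expr_unbounded 3 z1.
have N0 : (0 < N)%N by case: N hN => //; rewrite expr0; lra.
have [n0 hn0] := expr_unbounded (3 / (b - a)) z1.
pose n := exps N n0; pose c := (2 * a + b) / 3.
have stretch k : 3 <= width zeta n k * zeta ^+ n k.+1 by exact: exps_stretch.
have n_gt0 k : (0 < n k.+1)%N by exact: leq_trans (leq_exps n0 k.+1 N0).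
have width0 : width zeta n 0 <= (b - a) / 3.
  rewrite /width -exprD invf_ple ?posrE ?exprn_gt0 ?divr_gt0 ?subr_gt0//.
  by rewrite invf_div (le_trans hn0)// ler_weXn2l ?(ltW z1)// leq_addr.
exists (coded zeta n c); split; first exact: coded_inj.
move=> s; split.
  have := @coded_itv _ _ _ c z1 stretch s 0; rewrite /= /c; lra.
apply: sigma_bar_pinfty => // M.
have [m hm] := @coded_close _ _ _ c z1 stretch s M.
by exists (n M.+1), m; split=> //; exact: leq_exps.
Qed.

(** * Cardinality and density *)

Definition cut {R : realType} (x : R) (i : nat) : bool :=
  if (unpickle i : option rat) is Some q then ratr q < x else false.

Lemma cut_inj (R : realType) : injective (@cut R).
Proof.
have neq (x y : R) : x < y -> cut x <> cut y.
  move=> /rat_in_itvoo[q]; rewrite in_itv/= => /andP[xq qy].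
  move=> /(congr1 (@^~ (pickle q))); rewrite /cut pickleK qy.
  by rewrite ltNge (ltW xq).
move=> x y xy; have [/neq||//] := ltgtP x y; first by [].
by move=> /neq /(_ (esym xy)).
Qed.

Lemma Delta_infty_inj (R : realType) (zeta a b : R) : 1 < zeta -> a < b ->
  exists2 f : R -> R, injective f &
    forall x, (Delta_infty zeta `&` `]a, b[) (f x).
Proof.
move=> z1 ab.
(* [Delta_infty] excludes [0], so the points are coded in a subinterval on one
   side of [0]. *)
have [c [d [ac cd db cd0]]] : exists c d : R,
    [/\ a <= c, c < d, d <= b & (0 <= c) || (d <= 0)].
  have [b0|b0] := lerP b 0.
    by exists a, b; rewrite b0 orbT.
  by exists (Num.max a 0), b; rewrite !le_max !lexx orbT gt_max ab b0.
have [f [finj fP]] := sigma_bar_pinfty_cantor z1 cd.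
exists (f \o cut); first by apply: inj_comp => //; exact: cut_inj.
move=> x /=; have [/andP[cf fd] fs] := fP (cut x); split; [split=> //|].
  by case/orP: cd0 => ?; [rewrite gt_eqF | rewrite lt_eqF]; lra.
by rewrite /= in_itv/=; lra.
Qed.

Theorem theorem3p5 (R : realType) (zeta : R) (hzeta : 1 < zeta) :
  (forall a b : R, a < b ->
     (Delta_infty zeta `&` `]a, b[) #= [set: R]) /\
  dense (Delta_infty zeta).
Proof.
split=> [a b ab|O [x Ox] Oopen].
  have [f finj fP] := Delta_infty_inj hzeta ab.
  apply: Cantor_Bernstein; first exact: card_leT.
  apply/card_subP; exists (range f); last by move=> _ [x _ <-].
  by apply: inj_card_eq => x y _ _; exact: finj.
have sub := open_itvoo_subset Oopen Ox.
near (0:R)^'+ => r.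
have r0 : 0 < r by [].
have xr : x - r < x + r by lra.
have [f _ /(_ 0)[fD fI]] := Delta_infty_inj hzeta xr.
by exists (f 0); split=> //; apply: (near sub r).
Unshelve. all: by end_near.
Qed.
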